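(* Let $b\in\mathfrak m_{\mathsf I}$. The solution $M$ of the right half-shuffle fixed point equation $$M=\varepsilon+M\succ b$$ lies in $\mathsf M_{\mathsf I}$ and satisfies, for every translucent word $t$ and every incomplete word $w\in\mathcal W(t)$, $$M(w)=\sum_{\pi\in\mathcal I(t)}\ \prod_{V\in\pi}b(w|_V),$$ where $\mathcal I(t)$ is the set of incomplete interval bipartitions of type $t$.
   Context: Write $\llbracket n\rrbracket=\{1,\dots,n\}$; $A\subset B$ allows equality. For a word $w$ of length $|w|$ and $A=\{i_1<\dots<i_p\}\subset\llbracket|w|\rrbracket$, $w|_A=w(i_1)\cdots w(i_p)$. Translucent words. A translucent word is a pair $t=(\alpha_t,b_t)$ of words of equal length $|t|\ge0$, $\alpha_t\in\{\mathsf L,\mathsf R\}^\star$, $b_t\in\{0,1\}^\star$. Put $[t]_0=\{i:b_t(i)=0\}$, $[t]_1=\{i:b_t(i)=1\}$, $t(i)=(\alpha_t(i),b_t(i))$. The necklace order $\lessdot$ on $\llbracket|t|\rrbracket$ is the total order in which all $\mathsf L$-positions precede all $\mathsf R$-positions, the $\mathsf L$-positions being ordered increasingly and the $\mathsf R$-positions decreasingly. For nonempty $A$, $\dot\bigwedge A$ is its $\lessdot$-minimum. $\mathrm{int}(t)$ is the set of maximal (nonempty) intervals of $(\llbracket|t|\rrbracket,\lessdot)$ contained in $[t]_1$. Incomplete words. Fix finite sets $\dot S^{\mathsf L},\dot S^{\mathsf R}$ of left and right random variables (finite subsets of two subalgebras of a unital complex algebra, treated as disjoint and disjoint from the placeholder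 symbols $\mathsf L,\mathsf R$). Put $S^{(\mathsf L,0)}=\{\mathsf L\}$, $S^{(\mathsf R,0)}=\{\mathsf R\}$, $S^{(\mathsf L,1)}=\dot S^{\mathsf L}$, $S^{(\mathsf R,1)}=\dot S^{\mathsf R}$, and $\mathcal W(t)=S^{t(1)}\times\cdots\times S^{t(|t|)}$; its elements are the incomplete words of type $t$. For $w\in\mathcal W(t)$ put $[w]_i=[t]_i$, $\mathrm{int}(w)=\mathrm{int}(t)$; the translucidation $w_{I\leadsto0}$ ($I\subset\llbracket|w|\rrbracket$) is obtained by replacing $w(j)$ by the placeholder $\alpha_t(j)$ for every $j\in I$. $\mathcal W$ is the collection of all incomplete words. A linear form on $\mathbb C\mathcal W$ is a linear functional on $\bigoplus_t\mathbb C\mathcal W(t)$, i.e. is given by arbitrary values on incomplete words. Half-shuffle product. $\varepsilon(w)=1$ if $w\in\{\mathsf L,\mathsf R\}^\star$ (only placeholders), $\varepsilon(w)=0$ otherwise. $\mathfrak g$ is the space of linear forms vanishing on $\{\mathsf L,\mathsf R\}^\star$. For $f,g\in\mathfrak g$, $f\succ g\in\mathfrak g$ is $$(f\succ g)(w)=\sum_{\substack{[w]_0\subsetneq I\subsetneq\llbracket|w|\rrbracket\\ \dot\bigwedge[w]_1\notin I}}f(w|_I)\,g(w_{I\leadsto0})\qquad([w]_1\neq\varnothing),$$ and $\varepsilon\succ g=g$; so for $M$ with $M-\varepsilon\in\mathfrak g$, $M\succ b=b+(M-\varepsilon)\succ b$. $\mathsf M_{\mathsf I}$ is the set of linear forms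 $f$ on $\mathbb C\mathcal W$ with $f(w)=\prod_{J\in\mathrm{int}(w)}f(w|_J)$ for all $w\in\mathcal W$ (empty product $=1$). $\mathfrak m_{\mathsf I}$ is the set of linear forms $f$ on $\mathbb C\mathcal W$ such that $f(w)=0$ whenever $|\mathrm{int}(w)|\ne1$, and $f(w)=f(w|_{[w]_1})$ whenever $|\mathrm{int}(w)|=1$. It is a Lie algebra (indeed a preLie algebra). Partitions. An incomplete interval bipartition of type $t$ is a set partition $\pi$ of $[t]_1$ such that each block of $\pi$ is an interval for the restriction of the order $\lessdot$ to $[t]_1$ (that is, if $a\lessdot c\lessdot d$ are elements of $[t]_1$ and $a,d$ lie in the same block, then $c$ lies in that block too). The set $[t]_0$ is not considered a block of $\pi$ and is therefore not necessarily a $\lessdot$-interval.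
   Formalization: Blocks of an incomplete interval bipartition are required to be intervals of the necklace order on all positions, not just of its restriction to [t]_1; with the latter the formula fails for xLy (x, y left variables), where it gives b(xy)+b(x)b(y) but M(xLy)=b(x)b(y). *)

(* Defs.v *)
From HB Require Import structures.
From mathcomp Require Import all_boot all_order all_algebra.
From mathcomp Require Import reals complex.

Set Implicit Arguments.
Unset Strict Implicit.
Unset Printing Implicit Defensive.

Import GRing.Theory.
Local Open Scope ring_scope.

Inductive side := sL | sR.

(* A translucent word of length n is an n-tuple t of pairs (alpha_t(i), b_t(i)),
   with b_t(i) a bool; positions are 0-based. *)
Definition tlabel : Type := (side * bool)%type.

Definition zeros n (t : n.-tuple tlabel) : {set 'I_n} :=
  [set i | ~~ (tnth t i).2].

Definition ones n (t : n.-tuple tlabel) : {set 'I_n} :=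
  [set i | (tnth t i).2].

Definition necklace_lt n (t : n.-tuple tlabel) (i j : 'I_n) : bool :=
  match (tnth t i).1, (tnth t j).1 with
  | sL, sL => (i < j)%N
  | sL, sR => true
  | sR, sL => false
  | sR, sR => (j < i)%N
  end.

(* [None] exactly when A is empty. *)
Definition necklace_min n (t : n.-tuple tlabel) (A : {set 'I_n}) : option 'I_n :=
  [pick m in A | [forall j in A, (j != m) ==> necklace_lt t m j]].

(* Intervals of the whole set of positions, not of a subset of it. *)
Definition necklace_interval n (t : n.-tuple tlabel) (A : {set 'I_n}) : bool :=
  [forall a in A, forall d in A, forall c,
     necklace_lt t a c && necklace_lt t c d ==> (c \in A)].

Definition int_blocks n (t : n.-tuple tlabel) : {set {set 'I_n}} :=
  [set J | maxset (fun A => [&& A != set0, necklace_interval t A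
                              & A \subset ones t]) J].

(* Set partitions of [ones t] whose blocks are intervals of the necklace order
   on all positions: a block may not jump over a position of [zeros t].
   If intervals were taken only relative to [ones t], the word x L y (x, y left
   variables) would have the one-block partition {x, y}, and the partition
   formula would give b(xy) + b(x) b(y), whereas the fixed point equation and
   the factorization over [int_blocks] both give b(x) b(y). *)
Definition interval_bipartitions n (t : n.-tuple tlabel) : {set {set {set 'I_n}}} :=
  [set P | partition P (ones t) && [forall V in P, necklace_interval t V]].

Definition subword T n (w : n.-tuple T) (A : {set 'I_n}) : seq T :=
  [seq tnth w i | i <- enum A].

Section Words.

Variables SL SR : finType.

(* [inl None] and [inr None] are the placeholders L and R; the sum makes the
   left and right variables disjoint from each other and from these. *)
Definition letter : Type := (option SL + option SR)%type.

Definition letter_type (x : letter) : tlabel :=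
  match x with
  | inl o => (sL, isSome o)
  | inr o => (sR, isSome o)
  end.

Definition placeholder (x : letter) : letter :=
  match x with
  | inl _ => inl None
  | inr _ => inr None
  end.

(* The letter sets being disjoint, a word over [letter] has exactly one type:
   W(t) is the set of w with [word_type w = t], and the collection of all
   incomplete words is [seq letter]. *)
Definition word_type n (w : n.-tuple letter) : n.-tuple tlabel :=
  map_tuple letter_type w.

Definition translucidate n (w : n.-tuple letter) (I : {set 'I_n}) : n.-tuple letter :=
  [tuple if i \in I then placeholder (tnth w i) else tnth w i | i < n].

Variable R : realType.

Definition linform : Type := seq letter -> R[i].

Definition epsilon : linform :=
  fun w => if ones (word_type (in_tuple w)) == set0 then 1 else 0.

Definition in_g (f : linform) : Prop :=
  forall w, ones (word_type (in_tuple w)) = set0 -> f w = 0.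

(* The sum is empty when w consists of placeholders only. *)
Definition half_shuffle (f g : linform) : linform := fun w0 =>
  let w := in_tuple w0 in
  let t := word_type w in
  \sum_(I : {set 'I_(size w0)} |
      [&& zeros t \proper I, I \proper setT
        & if necklace_min t (ones t) is Some m then m \notin I else false])
     f (subword w I) * g (translucidate w I).

(* M = epsilon + M > b, where M > b = b + (M - epsilon) > b. *)
Definition is_solution (b M : linform) : Prop :=
  in_g (fun w => M w - epsilon w) /\
  forall w, M w =
    epsilon w + (b w + half_shuffle (fun u => M u - epsilon u) b w).

Definition in_MI (f : linform) : Prop :=
  forall n (w : n.-tuple letter),
    f w = \prod_(J in int_blocks (word_type w)) f (subword w J).

Definition in_mI (f : linform) : Prop :=
  forall n (w : n.-tuple letter),
    let t := word_type w in
    (#|int_blocks t| <> 1%N -> f w = 0) /\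
    (#|int_blocks t| = 1%N -> f w = f (subword w (ones t))).

End Words.

(* Main.v *)
Require Import Defs.
From mathcomp Require Import all_boot all_order all_algebra.
From mathcomp Require Import reals complex.

Set Implicit Arguments.
Unset Strict Implicit.
Unset Printing Implicit Defensive.

Import GRing.Theory.
Local Open Scope ring_scope.

(** The solution is the partition formula itself, so everything reduces to
    facts on sums over set partitions of products of block weights,
    [part_sum F D], where F V is b (w|_V) if V is a necklace interval and 0
    otherwise.

    Sorting the partitions of D by the block V containing a given point x gives
    the recursion [part_sum_rec].  It implies, by induction on the size of D,
    that [part_sum F] is multiplicative as soon as F kills every nonempty
    block that is not contained in one of the pieces ([part_sumU],
    [part_sum_cover]).

    Fixed point equation ([bipartition_form_rec]).  Let m be the necklace
    minimum of [w]_1 and write V for the complement of I in the half-shuffle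
    sum, so that m lies in V and V is a subset of [w]_1 other than [w]_1 itself.
    Since b is in m_I, b (w_{I ~> 0}) is b (w|_V) if V is a necklace interval
    and 0 otherwise, which is exactly the weight of V; the missing term
    V = [w]_1 is b (w).  It remains to see that the partition formula for
    w|_{~V} sums over the partitions of [w]_1 minus V into necklace intervals of
    w.  A block which is an interval once V is deleted is one in w as well,
    because V is an interval starting at the minimum m of [w]_1, so that every
    other position of [w]_1 comes after the whole of V
    ([bipartition_form_setC]).  The equation is thus the recursion at m.

    Factorization ([bipartition_form_MI]).  A necklace interval contained in
    [w]_1 lies in a single maximal one, hence multiplicativity applies with the
    elements of int (w) as pieces.

    Uniqueness ([solution_unique]) is an induction on the length of w, as the
    right-hand side of the equation evaluates M at proper subwords of w only. *)

(** * Sums over set partitions *)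

Section PartitionSum.

Variable K : comPzRingType.

(** The sum over the set partitions of D of the products of the weights F of
    their blocks. *)
Definition part_sum (T : finType) (F : {set T} -> K) (D : {set T}) : K :=
  \sum_(P | partition P D) \prod_(V in P) F V.

Variable T : finType.
Implicit Types (F G : {set T} -> K) (D V : {set T}).

Lemma part_sum0 F : part_sum F set0 = 1.
Proof.
rewrite /part_sum (big_pred1 set0) ?big_set0 // => P.
by rewrite partition_set0.
Qed.

Lemma eq_part_sum F G D :
  (forall V, V != set0 -> V \subset D -> F V = G V) ->
  part_sum F D = part_sum G D.
Proof.
move=> FG; apply: eq_bigr => P PD; apply: eq_bigr => V VP; apply: FG.
  exact: partition_neq0 PD VP.
exact: partitionS PD VP.
Qed.

(** Partitions of D are sorted by the block V containing x. *)
Lemma part_sum_rec F D x : x \in D ->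
  part_sum F D =
  \sum_(V : {set T} | (x \in V) && (V \subset D)) F V * part_sum F (D :\: V).
Proof.
move=> xD; rewrite {1}/part_sum.
rewrite (partition_big (fun P => pblock P x)
  (fun V : {set T} => (x \in V) && (V \subset D))) /=; last first.
  move=> P PD; rewrite mem_pblock (cover_partition PD) xD /=.
  by apply: (partitionS PD); rewrite pblock_mem // (cover_partition PD).
apply: eq_bigr => V /andP[xV VD].
rewrite mulr_sumr.
rewrite (reindex_onto (fun P => V |: P) (fun P => P :\ V)) /=; last first.
  move=> P /andP[PD /eqP xP]; rewrite setD1K // -xP pblock_mem //.
  by rewrite (cover_partition PD).
have V0 : V != set0 by apply/set0Pn; exists x.
(* V, which contains x, is not a block of a partition of D minus V. *)
have VnP P : partition P (D :\: V) -> V \notin P.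
  move=> PD; apply/negP => VP.
  by have := subsetP (partitionS PD VP) x xV; rewrite inE xV.
apply: eq_big => [P|P]; last first.
  move=> /andP[/andP[_ _] /eqP <-].
  by rewrite big_setU1 //= !inE eqxx.
apply/andP/idP => [[/andP[PD _] /eqP PV]|PD].
  by rewrite -PV; apply: partitionD1 => //; rewrite setU11.
have VPD : partition (V |: P) D.
  rewrite -(setID D V) (setIidPr VD); apply: partitionU1 => //.
  by rewrite disjoint_sym disjoints_subset subsetDr.
rewrite VPD /= (@def_pblock _ _ V) ?setU11 ?(partition_trivIset VPD) //.
by rewrite eqxx setU1K ?VnP.
Qed.

(** The hypothesis says that blocks meeting both D1 and D2 have weight 0. *)
Lemma part_sumU F D1 D2 : [disjoint D1 & D2] ->
  (forall V, V != set0 -> V \subset D1 :|: D2 ->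
     ~~ (V \subset D1) -> ~~ (V \subset D2) -> F V = 0) ->
  part_sum F (D1 :|: D2) = part_sum F D1 * part_sum F D2.
Proof.
have [n] := ubnP #|D1|; elim: n => // n IHn in D1 *.
rewrite ltnS => D1n dis F0.
have [->|[x xD1]] := set_0Vmem D1; first by rewrite set0U part_sum0 mul1r.
rewrite (part_sum_rec _ xD1) (@part_sum_rec _ _ x) ?inE ?xD1 // mulr_suml.
rewrite (bigID (fun V : {set T} => V \subset D1)) /=.
rewrite [X in _ + X]big1 ?addr0; last first.
  move=> V /andP[/andP[xV VD] VnD1]; rewrite F0 ?mul0r //.
    by apply/set0Pn; exists x.
  by apply/subsetPn; exists x => //; rewrite (disjointFr dis).
apply: eq_big => [V|V /andP[/andP[xV _] VD1]].
  have [VD1|] := boolP (V \subset D1); last by rewrite !andbF.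
  by rewrite (subset_trans VD1 (subsetUl _ _)) !andbT.
have -> : (D1 :|: D2) :\: V = (D1 :\: V) :|: D2.
  rewrite setDUl; congr (_ :|: _); apply/setDidPl.
  by rewrite disjoint_sym; apply: disjointWl dis.
rewrite -mulrA IHn //.
- apply: leq_trans D1n; apply: proper_card; rewrite properE subsetDl /=.
  by apply/subsetPn; exists x => //; rewrite inE xV.
- by apply: disjointWl dis; apply: subsetDl.
move=> W W0 WD WD1 WD2; apply: F0 => //.
  by apply: subset_trans WD _; apply: setSU; apply: subsetDl.
apply: contra WD1 => WD1; apply/subsetP => y yW.
by have := subsetP WD y yW; rewrite !inE (disjointFr dis) ?orbF ?(subsetP WD1).
Qed.

Lemma part_sum_cover F (Q : {set {set T}}) : trivIset Q ->
  (forall V, V != set0 -> V \subset cover Q ->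
     (forall J, J \in Q -> ~~ (V \subset J)) -> F V = 0) ->
  part_sum F (cover Q) = \prod_(J in Q) part_sum F J.
Proof.
have [n] := ubnP #|Q|; elim: n => // n IHn in Q *.
rewrite ltnS => Qn tQ F0.
have [->|[J JQ]] := set_0Vmem Q; first by rewrite /cover !big_set0 part_sum0.
have covE : cover Q = J :|: cover (Q :\ J) by rewrite /cover (big_setD1 J).
have dis : [disjoint J & cover (Q :\ J)].
  apply: bigcup_disjoint => B; rewrite !inE => /andP[BJ BQ].
  by move/trivIsetP: tQ; apply; rewrite // eq_sym.
rewrite covE part_sumU //.
  rewrite (big_setD1 J) //=; congr (_ * _); apply: IHn.
  - by apply: leq_trans Qn; rewrite [X in (_ < X)%N](cardsD1 J) JQ.
  - by apply: trivIsetS tQ; apply: subsetDl.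
  move=> V V0 VQ VJ; apply: F0 => //; first by rewrite covE subsetU ?VQ ?orbT.
  move=> B BQ; have [->|BJ] := eqVneq B J; last by apply: VJ; rewrite !inE BJ.
  have /set0Pn[x xV] := V0; apply/subsetPn; exists x => //.
  by rewrite (disjointFl dis) // (subsetP VQ).
move=> V V0 VQ VJ VQJ; apply: F0 => //; first by rewrite covE.
move=> B BQ; have [->//|BJ] := eqVneq B J.
apply: contra VQJ => VB; apply: subset_trans VB _.
by apply: bigcup_sup; rewrite !inE BJ.
Qed.

End PartitionSum.

Lemma part_sum_imset (K : comPzRingType) (T T' : finType) (f : T' -> T)
    (F : {set T} -> K) (D : {set T'}) : injective f ->
  part_sum F (f @: D) = part_sum (fun V : {set T'} => F (f @: V)) D.
Proof.
move=> fI; have [n] := ubnP #|D|; elim: n => // n IHn in D *.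
rewrite ltnS => Dn.
have [->|[x xD]] := set_0Vmem D; first by rewrite imset0 !part_sum0.
rewrite (part_sum_rec _ xD) (part_sum_rec _ (imset_f f xD)).
have fK (V : {set T'}) : f @^-1: (f @: V) = V :> {set T'}.
  by apply/setP => y; rewrite inE mem_imset.
rewrite (reindex_onto (fun V : {set T'} => f @: V)
  (fun V : {set T} => f @^-1: V)) /=; last first.
  move=> V /andP[_ /subsetP VD]; apply/setP => y; apply/imsetP/idP => [[z]|yV].
    by rewrite inE => ? ->.
  by have /imsetP[z _ yz] := VD y yV; exists z; rewrite // inE -yz.
apply: eq_big => [V|V /andP[/andP[xV _] _]].
  rewrite fK eqxx andbT mem_imset //; congr (_ && _); apply/idP/idP.
    by move=> /(preimsetS f); rewrite !fK.
  exact: imsetS.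
rewrite mem_imset // in xV.
have -> : (f @: D) :\: (f @: V) = f @: (D :\: V).
  apply/setP => y; rewrite inE; apply/andP/imsetP => [[yV /imsetP[z zD yz]]|].
    by exists z => //; rewrite inE zD andbT; rewrite yz mem_imset in yV.
  by move=> [z /[!inE] /andP[zV zD] ->]; rewrite !mem_imset.
rewrite IHn //; apply: leq_trans Dn; apply: proper_card.
by rewrite properE subsetDl /=; apply/subsetPn; exists x => //; rewrite inE xV.
Qed.

(** * The necklace order and its intervals *)

Section Necklace.

Variables (n : nat) (t : n.-tuple tlabel).
Implicit Types A J U V : {set 'I_n}.

Lemma necklace_lt_irr : irreflexive (necklace_lt t).
Proof. by move=> i; rewrite /necklace_lt; case: (tnth t i).1; rewrite ltnn. Qed.

Lemma necklace_lt_trans : transitive (necklace_lt t).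
Proof.
move=> j i k; rewrite /necklace_lt.
case: (tnth t i).1; case: (tnth t j).1; case: (tnth t k).1 => //.
  exact: ltn_trans.
by move=> ji kj; apply: ltn_trans kj ji.
Qed.

Lemma necklace_lt_total i j : i != j -> necklace_lt t i j || necklace_lt t j i.
Proof.
rewrite /necklace_lt -val_eqE neq_ltn /=.
by case: (tnth t i).1; case: (tnth t j).1 => //; rewrite orbC.
Qed.

Lemma necklace_minP (A : {set 'I_n}) : A != set0 ->
  exists2 m, necklace_min t A = Some m &
    m \in A /\ forall j, j \in A -> j != m -> necklace_lt t m j.
Proof.
rewrite /necklace_min => A0; case: pickP => [m /andP[mA /forall_inP mP]|noP].
  by exists m => //; split=> // j jA; apply/implyP/mP.
case/set0Pn: A0 => x xA.
(* The minimum is the element of A with the fewest predecessors in A. *)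
case: (@arg_minnP _ x (mem A)
  (fun i => #|[set j in A | necklace_lt t j i]|) xA) => m.
rewrite -[mem A m]/(m \in A) => mA mP.
case/negP: (negbT (noP m)); rewrite mA.
apply/forall_inP => j jA; apply/implyP => jm.
case/orP: (necklace_lt_total jm) => // ltjm.
suff : (#|[set i in A | necklace_lt t i j]|
          < #|[set i in A | necklace_lt t i m]|)%N.
  by rewrite ltnNge mP.
apply/proper_card/properP; split.
  apply/subsetP => i; rewrite !inE => /andP[-> ij].
  exact: necklace_lt_trans ij ltjm.
by exists j; rewrite !inE ?jA // necklace_lt_irr.
Qed.

(** V is an interval for the restriction of the necklace order to A; V is not
    required to be contained in A. *)
Definition interval_in (A V : {set 'I_n}) : bool :=
  [forall a in V, forall d in V, forall c in A,
     necklace_lt t a c && necklace_lt t c d ==> (c \in V)].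

Lemma interval_inP A V :
  reflect (forall a d c, a \in V -> d \in V -> c \in A ->
             necklace_lt t a c -> necklace_lt t c d -> c \in V)
          (interval_in A V).
Proof.
apply: (iffP forall_inP) => [h a d c aV dV cA ac cd|h a aV].
  have /forall_inP/(_ d dV)/forall_inP/(_ c cA) := h a aV.
  by rewrite ac cd.
apply/forall_inP => d dV; apply/forall_inP => c cA.
apply/implyP => /andP[ac cd].
exact: h ac cd.
Qed.

Lemma interval_inT V : interval_in setT V = necklace_interval t V.
Proof.
apply: eq_forallb => a; congr (_ ==> _).
apply: eq_forallb => d; congr (_ ==> _).
by apply: eq_forallb => c; rewrite inE.
Qed.

Lemma necklace_intervalP V :
  reflect (forall a d c, a \in V -> d \in V ->
             necklace_lt t a c -> necklace_lt t c d -> c \in V)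
          (necklace_interval t V).
Proof.
rewrite -interval_inT; apply: (iffP (interval_inP _ _)) => h a d c.
  by move=> aV dV; apply: h.
by move=> aV dV _; apply: h.
Qed.

Lemma interval_in_interval J V : necklace_interval t J -> V \subset J ->
  interval_in J V = necklace_interval t V.
Proof.
move=> /necklace_intervalP Ji /subsetP VJ.
apply/interval_inP/necklace_intervalP => h a d c aV dV; last first.
  by move=> _; apply: h.
by move=> ac cd; apply: (h a d c) => //; apply: (Ji a d) => //; apply: VJ.
Qed.

Lemma necklace_intervalU U V x :
  necklace_interval t U -> necklace_interval t V -> x \in U -> x \in V ->
  necklace_interval t (U :|: V).
Proof.
move=> /necklace_intervalP Ui /necklace_intervalP Vi xU xV.
apply/necklace_intervalP => a d c; rewrite !inE => /orP aUV /orP dUV ac cd.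
have [->|/necklace_lt_total/orP[cx|xc]] := eqVneq c x; first by rewrite xU.
  by case: aUV => [aU|aV]; [rewrite (Ui a x) | rewrite (Vi a x) // orbT].
by case: dUV => [dU|dV]; [rewrite (Ui x d) | rewrite (Vi x d) // orbT].
Qed.

Lemma int_blocks_max V :
  V != set0 -> necklace_interval t V -> V \subset ones t ->
  exists2 J, J \in int_blocks t & V \subset J.
Proof.
move=> V0 Vi V1.
have [|J Jmax VJ] := @maxset_exists _ (fun A : {set 'I_n} =>
  [&& A != set0, necklace_interval t A & A \subset ones t]) V.
  by apply/and3P.
by exists J; rewrite // inE.
Qed.

Lemma int_blockP J : J \in int_blocks t ->
  [/\ J != set0, necklace_interval t J & J \subset ones t].
Proof. by rewrite inE => /maxsetP[/and3P]. Qed.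

Lemma int_blocks_trivIset : trivIset (int_blocks t).
Proof.
apply/trivIsetP => J K Jt Kt; apply: contraNT; rewrite -setI_eq0.
case/set0Pn => x /setIP[xJ xK].
have [J0 Ji J1] := int_blockP Jt; have [K0 Ki K1] := int_blockP Kt.
have JKP : [&& J :|: K != set0, necklace_interval t (J :|: K)
          & J :|: K \subset ones t].
  rewrite (necklace_intervalU Ji Ki xJ xK) subUset J1 K1 !andbT.
  by apply/set0Pn; exists x; rewrite inE xJ.
move: Jt Kt; rewrite !inE => /maxsetP[_ Jm] /maxsetP[_ Km]; apply/eqP.
by rewrite -(Jm _ JKP (subsetUl _ _)) [LHS](Km _ JKP (subsetUr _ _)).
Qed.

Lemma cover_int_blocks : cover (int_blocks t) = ones t.
Proof.
apply/eqP; rewrite eqEsubset; apply/andP; split.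
  by apply/bigcupsP => J /int_blockP[].
apply/subsetP => x x1.
have [|||J Jt] := @int_blocks_max [set x]; last first.
- by rewrite sub1set => xJ; apply/bigcupP; exists J.
- by rewrite sub1set.
- apply/necklace_intervalP => a d c; rewrite !inE => /eqP-> /eqP-> xc cx.
  by have := necklace_lt_trans xc cx; rewrite necklace_lt_irr.
by apply/set0Pn; exists x; rewrite inE.
Qed.

Lemma card_int_blocks_eq1 :
  (#|int_blocks t| == 1%N) = (ones t != set0) && necklace_interval t (ones t).
Proof.
apply/cards1P/andP => [[J tJ]|[t0 ti]].
  have := cover_int_blocks; rewrite tJ /cover big_set1 => <-.
  by have [] := @int_blockP J; rewrite ?tJ ?inE.
exists (ones t); apply/setP => J; rewrite inE; apply/idP/eqP => [Jt|->].
  have [J0 Ji J1] := int_blockP Jt; move: Jt; rewrite inE => /maxsetP[_ Jm].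
  by rewrite [RHS]Jm //; apply/and3P.
rewrite inE; apply/maxsetP; split; first by apply/and3P.
by move=> B /and3P[_ _ B1] oB; apply/eqP; rewrite eqEsubset B1.
Qed.

End Necklace.

(** * Subwords of subwords *)

Lemma sorted_enum_ord n (A : {set 'I_n}) :
  sorted (fun i j : 'I_n => (i < j)%N) (enum A).
Proof.
rewrite {1}/enum_mem; apply: sorted_filter.
  by move=> ? ? ?; apply: ltn_trans.
rewrite -(sorted_map (f := val) (e' := ltn)) -enumT val_enum_ord.
exact: iota_ltn_sorted.
Qed.

Lemma enum_imset_mono m n (f : 'I_m -> 'I_n) (V : {set 'I_m}) :
  {homo f : i j / (i < j)%N} -> enum (f @: V) = [seq f i | i <- enum V].
Proof.
move=> fmono; apply: (@irr_sorted_eq _ (fun i j : 'I_n => (i < j)%N)).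
- by move=> ? ? ?; apply: ltn_trans.
- by move=> ?; apply: ltnn.
- exact: sorted_enum_ord.
- rewrite sorted_map; apply: sub_sorted (sorted_enum_ord V) => i j /=.
  exact: fmono.
move=> y; rewrite mem_enum; apply/imsetP/mapP => -[x xV ->]; exists x => //.
  by rewrite mem_enum.
by rewrite mem_enum in xV.
Qed.

Lemma enum_val_mono n (A : {set 'I_n}) :
  {homo (@enum_val _ (mem A)) : i j / (i < j)%N}.
Proof.
move=> i j ij; have [x _] : exists x : 'I_n, true by exists (enum_val i).
rewrite !(enum_val_nth x).
apply: (sorted_ltn_nth _ _ (sorted_enum_ord A)) => //.
- by move=> ? ? ?; apply: ltn_trans.
- by rewrite inE -cardE.
by rewrite inE -cardE.
Qed.

Lemma enum_val_ltn n (A : {set 'I_n}) (i j : 'I_#|A|) :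
  (enum_val i < enum_val j)%N = (i < j)%N.
Proof.
case: (ltngtP i j) => [ij|ji|/val_inj ->]; last exact: ltnn.
  exact: enum_val_mono.
by rewrite ltnNge ltnW // enum_val_mono.
Qed.

Lemma tuple_ind_in (T : Type) (P : forall n, n.-tuple T -> Prop) :
  (forall s : seq T, P (size s) (in_tuple s)) ->
  forall n (w : n.-tuple T), P n w.
Proof.
move=> Pin n [s hs]; have sn : size s = n by apply/eqP.
subst n; rewrite (_ : Tuple hs = in_tuple s) //; exact: val_inj.
Qed.

Section Words.

Variables (SL SR : finType) (R : realType).
Notation letter := (letter SL SR).
Notation linform := (linform SL SR R).
Implicit Types b M : linform.

(** The word w|_A as a tuple of length #|A|, so that its positions are related
    to those of w by [enum_val]. *)
Definition subtuple n (w : n.-tuple letter) (A : {set 'I_n}) :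
    #|A|.-tuple letter :=
  [tuple tnth w (enum_val i) | i < #|A|].

Lemma val_subtuple n (w : n.-tuple letter) (A : {set 'I_n}) :
  subtuple w A = subword w A :> seq _.
Proof.
have sz : size (subword w A) = #|A| by rewrite size_map -cardE.
(* The letter inl None is an arbitrary default value. *)
apply: (@eq_from_nth _ (inl None)); rewrite size_tuple ?sz // => i iA.
rewrite -[i in LHS]/(val (Ordinal iA)) -tnth_nth tnth_mktuple.
move: (enum_val _) (enum_val_nth (enum_val (Ordinal iA)) (Ordinal iA)) => x ->.
by rewrite (nth_map x) -?cardE.
Qed.

Lemma subword_subtuple n (w : n.-tuple letter) (A : {set 'I_n})
    (V : {set 'I_#|A|}) :
  subword (subtuple w A) V = subword w (enum_val @: V).
Proof.
rewrite /subword (enum_imset_mono _ (@enum_val_mono _ A)) -map_comp.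
by apply: eq_map => i; rewrite /= tnth_mktuple.
Qed.

Lemma necklace_lt_subtuple n (w : n.-tuple letter) (A : {set 'I_n}) i j :
  necklace_lt (word_type (subtuple w A)) i j =
  necklace_lt (word_type w) (enum_val i) (enum_val j).
Proof.
by rewrite /necklace_lt !tnth_map !tnth_ord_tuple !enum_val_ltn.
Qed.

Lemma ones_subtuple n (w : n.-tuple letter) (A : {set 'I_n}) :
  enum_val @: ones (word_type (subtuple w A)) = ones (word_type w) :&: A.
Proof.
have onesE i : (i \in ones (word_type (subtuple w A))) =
               (enum_val i \in ones (word_type w)).
  by rewrite !inE !tnth_map !tnth_ord_tuple.
apply/setP => i; rewrite inE; apply/imsetP/andP => [[j j1 ->]|[i1 iA]].
  by rewrite -onesE j1 enum_valP.
by exists (enum_rank_in iA i); rewrite ?onesE enum_rankK_in.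
Qed.

Lemma interval_subtuple n (w : n.-tuple letter) (A : {set 'I_n})
    (V : {set 'I_#|A|}) :
  interval_in (word_type w) A (enum_val @: V) =
  necklace_interval (word_type (subtuple w A)) V.
Proof.
apply/interval_inP/necklace_intervalP => h a d c aV dV.
  rewrite !necklace_lt_subtuple => ac cd.
  rewrite -(mem_imset _ _ enum_val_inj); apply: h ac cd; rewrite ?mem_imset //.
  - exact: enum_val_inj.
  - exact: enum_val_inj.
  exact: enum_valP.
case/imsetP: aV dV => {}a aV -> /imsetP[{}d dV ->] cA.
have <- := enum_rankK_in cA cA; rewrite -!necklace_lt_subtuple.
by rewrite mem_imset; [apply: h | apply: enum_val_inj].
Qed.

(** * The partition formula *)

(** The weight of V as a block in the word w|_A: intervals are taken among the
    positions in A only.  It is 0 if V is not such an interval. *)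
Definition block_weight b n (w : n.-tuple letter) (A V : {set 'I_n}) : R[i] :=
  if interval_in (word_type w) A V then b (subword w V) else 0.

(** The sum over incomplete interval bipartitions, as a linear form. *)
Definition bipartition_form b : linform := fun s =>
  \sum_(P in interval_bipartitions (word_type (in_tuple s)))
    \prod_(V in P) b (subword (in_tuple s) V).

Lemma bipartition_form_tuple b n (w : n.-tuple letter) :
  bipartition_form b w =
  \sum_(P in interval_bipartitions (word_type w))
    \prod_(V in P) b (subword w V).
Proof.
by elim/tuple_ind_in: n / w => s.
Qed.

Lemma epsilon_tuple n (w : n.-tuple letter) :
  epsilon R w = if ones (word_type w) == set0 then 1 else 0.
Proof.
by elim/tuple_ind_in: n / w => s.
Qed.

Lemma epsilon_subword n (w : n.-tuple letter) (A : {set 'I_n}) :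
  epsilon R (subword w A) = if ones (word_type w) :&: A == set0 then 1 else 0.
Proof. by rewrite -val_subtuple epsilon_tuple -ones_subtuple imset_eq0. Qed.

Lemma bipartition_formE b n (w : n.-tuple letter) :
  bipartition_form b w = part_sum (block_weight b w setT) (ones (word_type w)).
Proof.
rewrite bipartition_form_tuple /part_sum.
rewrite [RHS](bigID (fun P : {set {set 'I_n}} =>
  [forall V in P, necklace_interval (word_type w) V])) /=.
rewrite [X in _ + X]big1 ?addr0.
  apply: eq_big => [P|P]; rewrite inE // => /andP[_ /forall_inP Pi].
  by apply: eq_bigr => V /Pi; rewrite /block_weight interval_inT => ->.
move=> P /andP[_ /forall_inPn[V VP Vi]].
by rewrite (bigD1 V) //= /block_weight interval_inT (negbTE Vi) mul0r.
Qed.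

(** The partition formula for w|_A, read in w: blocks are intervals relative
    to A. *)
Lemma bipartition_form_subword b n (w : n.-tuple letter) (A : {set 'I_n}) :
  bipartition_form b (subword w A) =
  part_sum (block_weight b w A) (ones (word_type w) :&: A).
Proof.
rewrite -val_subtuple bipartition_formE -ones_subtuple.
rewrite part_sum_imset; last exact: enum_val_inj.
apply: eq_part_sum => V _ _.
by rewrite /block_weight interval_inT interval_subtuple subword_subtuple.
Qed.

Lemma bipartition_form_MI b : in_MI (bipartition_form b).
Proof.
move=> n w; rewrite bipartition_formE -cover_int_blocks part_sum_cover.
- apply: eq_bigr => J Jt; have [J0 Ji J1] := int_blockP Jt.
  rewrite bipartition_form_subword (setIidPr J1); apply: eq_part_sum => V _ VJ.
  by rewrite /block_weight interval_inT interval_in_interval.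
- exact: int_blocks_trivIset.
move=> V V0; rewrite cover_int_blocks /block_weight interval_inT => V1 VJ.
case: ifP => // Vi; have [J Jt sVJ] := int_blocks_max V0 Vi V1.
by have := VJ J Jt; rewrite sVJ.
Qed.

(** * The fixed point equation *)

(** There is exactly one maximal interval in the set of positions of variables if
    and only if that set is itself a nonempty necklace interval. *)
Lemma mI_form b (b_mI : in_mI b) n (w : n.-tuple letter) :
  b w = if (ones (word_type w) != set0) &&
           necklace_interval (word_type w) (ones (word_type w))
        then b (subword w (ones (word_type w))) else 0.
Proof.
have [b0 b1] := b_mI n w; rewrite -card_int_blocks_eq1.
by case: eqP => [/b1|/b0].
Qed.

Lemma necklace_lt_translucidate n (w : n.-tuple letter) (I : {set 'I_n}) :
  necklace_lt (word_type (translucidate w I)) =2 necklace_lt (word_type w).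
Proof.
move=> i j; rewrite /necklace_lt !tnth_map !tnth_ord_tuple.
by do 2!case: ifP => _ //; case: (tnth w i) => ?; case: (tnth w j).
Qed.

Lemma ones_translucidate n (w : n.-tuple letter) (I : {set 'I_n}) :
  ones (word_type (translucidate w I)) = ones (word_type w) :\: I.
Proof.
apply/setP => i; rewrite !inE !tnth_map !tnth_ord_tuple.
by case: ifP => //= _; case: (tnth w i).
Qed.

(** With V the set of positions of variables left in w after translucidation. *)
Lemma mI_translucidate b (b_mI : in_mI b) n (w : n.-tuple letter)
    (I V : {set 'I_n}) :
  V != set0 -> ones (word_type w) :\: I = V ->
  b (translucidate w I) = block_weight b w setT V.
Proof.
move=> V0 IV; rewrite (mI_form b_mI) ones_translucidate IV V0 /=.
rewrite /block_weight interval_inT.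
have -> : necklace_interval (word_type (translucidate w I)) V =
          necklace_interval (word_type w) V.
  by apply/necklace_intervalP/necklace_intervalP => h a d c aV dV;
     move: (h a d c aV dV); rewrite !necklace_lt_translucidate.
case: ifP => // _; congr (b _); apply/eq_in_map => i; rewrite mem_enum -IV inE.
by case/andP => /negbTE iI _; rewrite tnth_mktuple iI.
Qed.

(** Deleting an interval V that starts at the minimum m of the positions of
    variables creates no new interval among the remaining such positions. *)
Lemma bipartition_form_setC b n (w : n.-tuple letter) m (V : {set 'I_n}) :
  let t := word_type w in
  (forall j, j \in ones t -> j != m -> necklace_lt t m j) ->
  m \in V -> necklace_interval t V ->
  bipartition_form b (subword w (~: V)) =
  part_sum (block_weight b w setT) (ones t :\: V).
Proof.
move=> t mmin mV /necklace_intervalP Vi.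
rewrite bipartition_form_subword -setDE; apply: eq_part_sum => U _ /subsetP UV.
rewrite /block_weight interval_inT -/t; congr (if _ then _ else _).
apply/interval_inP/necklace_intervalP => h a d c aU dU; last first.
  by move=> _; apply: h.
move=> ac cd; apply: h (ac) (cd) => //; rewrite inE; apply/negP => cV.
(* If c were in V, then a, lying between m and c, would be in V as well. *)
have /setDP[a1 aV] := UV a aU; case/negP: aV; apply: (Vi m c) => //.
apply: mmin => //; apply: contraTneq aU => ->; apply/negP => /UV.
by rewrite inE mV.
Qed.

Lemma zeros_setC n (t : n.-tuple tlabel) : zeros t = ~: ones t.
Proof. by apply/setP => i; rewrite !inE. Qed.

(** The recursion at the necklace minimum; the term of the block [ones t]
    provides b s. *)
Lemma bipartition_form_rec b (b_mI : in_mI b) s :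
  let t := word_type (in_tuple s) in ones t != set0 ->
  bipartition_form b s =
  b s + half_shuffle (fun u => bipartition_form b u - epsilon R u) b s.
Proof.
set w := in_tuple s => t t0; have [m mE [m1 mmin]] := necklace_minP t t0.
rewrite (bipartition_formE b w) (part_sum_rec _ m1) -/t.
rewrite (bigD1 (ones t)) /=; last by rewrite m1 subxx.
rewrite setDv part_sum0 mulr1; congr (_ + _).
  by rewrite (mI_form b_mI w) t0 /= /block_weight interval_inT.
rewrite /half_shuffle -/w -/t mE.
(* The half-shuffle sum is indexed by the complement V of I. *)
rewrite [RHS](reindex_onto (fun V => ~: V) (fun I => ~: I)); last first.
  by move=> I _; rewrite setCK.
apply: eq_big => [V|V /andP[/andP[mV V1] Vn1]].
  rewrite setCK eqxx andbT zeros_setC properE !setCS properT inE negbK.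
  rewrite [V == _]eqEsubset.
  case mV: (m \in V); rewrite ?andbF //= andbT.
  have -> : ~: V != setT.
    by apply: contraTneq mV => VT; rewrite -[V]setCK VT setCT inE.
  by rewrite andbT; case: (V \subset _).
have V0 : V != set0 by apply/set0Pn; exists m.
rewrite (mI_translucidate b_mI V0); last by rewrite setDE setCK; apply/setIidPr.
(* The subword on the complement of V contains a variable: epsilon is 0. *)
rewrite epsilon_subword -setDE setD_eq0 -/t.
have -> : (ones t \subset V) = false.
  by apply: contraNF Vn1 => oV; rewrite eqEsubset V1.
rewrite subr0 mulrC; have [Vi|/negbTE Vi] := boolP (necklace_interval t V).
  by rewrite (bipartition_form_setC b mmin mV Vi).
by rewrite /block_weight interval_inT -/t Vi !mulr0.
Qed.

Lemma mI_epsilon b (b_mI : in_mI b) s :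
  ones (word_type (in_tuple s)) = set0 -> b s = 0.
Proof. by move=> s0; rewrite (mI_form b_mI (in_tuple s)) s0 eqxx. Qed.

Lemma bipartition_form_placeholders b s :
  ones (word_type (in_tuple s)) = set0 -> bipartition_form b s = 1.
Proof.
by move=> s0; rewrite (bipartition_formE b (in_tuple s)) s0 part_sum0.
Qed.

Lemma bipartition_form_solution b :
  in_mI b -> is_solution b (bipartition_form b).
Proof.
move=> b_mI; split=> s.
  by move=> s0; rewrite bipartition_form_placeholders // /epsilon s0 eqxx subrr.
rewrite /epsilon; case: eqP => [s0|/eqP s1].
  rewrite bipartition_form_placeholders // mI_epsilon //.
  rewrite /half_shuffle big1 ?addr0 //.
  move=> I; rewrite s0; case E: (necklace_min _ _) => [m|];
    last by rewrite !andbF.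
  by move: E; rewrite /necklace_min; case: pickP => // x; rewrite inE.
by rewrite add0r -bipartition_form_rec.
Qed.

Lemma solution_unique b M M' : is_solution b M -> is_solution b M' -> M' =1 M.
Proof.
move=> [_ Meq] [_ M'eq] s.
have [n] := ubnP (size s); elim: n => // n IHn in s *.
rewrite ltnS => sn; rewrite Meq M'eq; congr (_ + (_ + _)).
apply: eq_bigr => I /and3P[_ IT _]; congr ((_ - _) * _); apply: IHn.
rewrite size_map -cardE; apply: leq_trans sn.
by have := proper_card IT; rewrite cardsT card_ord.
Qed.

End Words.

Theorem theorem5p12 (R : realType) (SL SR : finType) (b : linform SL SR R)
    (b_mI : in_mI b) :
  exists M : linform SL SR R,
    [/\ is_solution b M,
        forall M' : linform SL SR R, is_solution b M' -> M' =1 M,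
        in_MI M
      & forall (n : nat) (t : n.-tuple tlabel) (w : n.-tuple (letter SL SR)),
          word_type w = t ->
          M w = \sum_(P in interval_bipartitions t)
                  \prod_(V in P) b (subword w V)].
Proof.
have sol := bipartition_form_solution b_mI.
exists (bipartition_form b); split=> //.
- by move=> M' sol'; apply: solution_unique sol'.
- exact: bipartition_form_MI.
by move=> n t w <-; apply: bipartition_form_tuple.
Qed.
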